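(* Let $\mathbf{A}$ be a directed graph on $V_N=\{1,\dots,N\}$ without self-loops and with adjacency matrix $(A_{jk})$, and let $\mathrm{g}$ be a coupling function. Consider the oscillator network $$\dot\theta_k=\omega+\sum_{j=1}^N A_{jk}\,\mathrm{g}(\theta_j-\theta_k),\qquad k=1,\dots,N,$$ on $\mathbb{T}^N$. For generic $\theta\in\mathbb{T}^N$ (that is, for all $\theta$ in some open dense subset of $\mathbb{T}^N$) the following hold for every partition $\{v^1,v^2\}$ of $V_N$ into two sets. 1. There is a directed graph cut $v^1\to v^2$ for the effective coupling graph $\mathcal{G}_{\mathrm{g},\mathbf{A}}(\theta)$, i.e. $E_{v^1\to v^2}(\mathcal{G}_{\mathrm{g},\mathbf{A}}(\theta))\neq\emptyset$ and $E_{v^2\to v^1}(\mathcal{G}_{\mathrm{g},\mathbf{A}}(\theta))=\emptyset$, if and only if the network has a local skew-product structure $v^1\to v^2$ at $\theta$. 2. The partition $\{v^1,v^2\}$ of the effective coupling graph $\mathcal{G}_{\mathrm{g},\mathbf{A}}(\theta)$ is disconnected, i.e. $E_{v^1\to v^2}(\mathcal{G}_{\mathrm{g},\mathbf{A}}(\theta))=E_{v^2\to v^1}(\mathcal{G}_{\mathrm{g},\mathbf{A}}(\theta))=\emptyset$, if and only if the network has a local product structure with respect to $(v^1,v^2)$ at $\theta$.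
   Context: $\mathbb{T}=\mathbb{R}/2\pi\mathbb{Z}$; $\omega\in\mathbb{R}$ is fixed. The adjacency matrix has $A_{jk}=1$ if there is an edge $(j,k)$ from $j$ to $k$, and $A_{jk}=0$ otherwise; $A_{kk}=0$. A coupling function is a non-constant smooth function $\mathrm{g}:\mathbb{T}\to\mathbb{R}$. Let $\mathrm{LC}(\mathrm{g})$ be the set of points of $\mathbb{T}$ having an open neighbourhood on which $\mathrm{g}$ is constant, and $\mathrm{DZ}(\mathrm{g})$ the set of points having an open neighbourhood on which $\mathrm{g}\equiv 0$. All coupling functions are assumed to have simple dead zones: $\mathrm{DZ}(\mathrm{g})$ has finitely many connected components and $\mathrm{LC}(\mathrm{g})=\mathrm{DZ}(\mathrm{g})$. The effective coupling graph $\mathcal{G}_{\mathrm{g},\mathbf{A}}(\theta)$ at $\theta\in\mathbb{T}^N$ is the directed graph on $V_N$ with edge set $\{(j,k): A_{jk}\ne 0 \text{ and } \theta_j-\theta_k\notin\mathrm{DZ}(\mathrm{g})\}$. For a directed graph $\mathbf{G}$ on $V_N$ and a partition $\{v^1,v^2\}$ of $V_N$ (a graph cut), $E_{v^p\to v^q}(\mathbf{G})=\{(j,k)\in E(\mathbf{G}): j\in v^p,\ k\in v^q\}$. The graph cut is directed $v^p\to v^q$ if $E_{v^p\to v^q}(\mathbf{G})\neq\emptyset$ and $E_{v^q\to v^p}(\mathbf{G})=\emptyset$. For $v\subset V_N$, $\theta_v$ denotes the tuple of coordinates $\theta_i$, $i\in v$, and $\mathbb{T}^N$ is identified with the product of the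 two coordinate tori, $\theta=(\theta_{v^1},\theta_{v^2})$. Let $\dot\theta=F(\theta)$ be an ODE on $\mathbb{T}^N$ with $F:\mathbb{T}^N\to\mathbb{R}^N$ smooth. It has a local skew-product structure $v^1\to v^2$ at $\theta$ if there are an open neighbourhood $U$ of $\theta$ and functions $F_{(1)},F_{(2)}$ such that $F(\vartheta)=(F_{(1)}(\vartheta_{v^1}),F_{(2)}(\vartheta_{v^1},\vartheta_{v^2}))$ for all $\vartheta\in U$ (the first block of components being those indexed by $v^1$, the second those indexed by $v^2$). It has a local product structure with respect to $(v^1,v^2)$ at $\theta$ if there are an open neighbourhood $U$ of $\theta$ and functions $F_{(1)},F_{(2)}$ such that $F(\vartheta)=(F_{(1)}(\vartheta_{v^1}),F_{(2)}(\vartheta_{v^2}))$ for all $\vartheta\in U$.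
   Formalization: Item 1 is proved with ''local skew-product structure and not a local product structure'' on its right side: as printed it fails, e.g. for an edgeless graph on two vertices, since a local product structure is also a local skew-product structure. *)

(* Defs.v *)
From HB Require Import structures.
From mathcomp Require Import all_boot all_order all_algebra.
From mathcomp Require Import all_classical all_reals all_analysis.
Set Implicit Arguments.
Unset Strict Implicit.
Unset Printing Implicit Defensive.
Import Order.TTheory GRing.Theory Num.Theory.
Import numFieldNormedType.Exports.
Local Open Scope classical_set_scope.
Local Open Scope ring_scope.

Definition twopiZ (R : realType) : {pred R} :=
  fun x => `[< exists n : int, x = n%:~R * (2 * pi) >].

Lemma twopiZ_zmod_closed (R : realType) : zmod_closed (@twopiZ R).
Proof.
split=> [|x y /asboolP[m ->] /asboolP[n ->]].
  by apply/asboolP; exists 0; rewrite mul0r.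
by apply/asboolP; exists (m - n); rewrite intrB mulrBl.
Qed.

HB.instance Definition _ (R : realType) :=
  GRing.isZmodClosed.Build R (@twopiZ R) (twopiZ_zmod_closed R).

(* The circle R / 2 pi Z, with the quotient topology and the quotient group
   structure.  The group laws are rebuilt because [quotient_topology] and
   [Quotient.quot] carry different choice structures. *)
Definition circle (R : realType) : Type :=
  quotient_topology (Quotient.quot (@twopiZ R)).

HB.instance Definition _ (R : realType) :=
  Topological.copy (circle R) (quotient_topology (Quotient.quot (@twopiZ R))).

HB.instance Definition _ (R : realType) :=
  GRing.isZmodule.Build (circle R)
    (@Quotient.addqA R (@twopiZ R)) (@Quotient.addqC R (@twopiZ R))
    (@Quotient.add0q R (@twopiZ R)) (@Quotient.addNq R (@twopiZ R)).

Definition angle (R : realType) (x : R) : circle R :=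
  (\pi_(Quotient.quot (@twopiZ R)) x)%qT.

Definition constant_fun (R : realType) (g : circle R -> R) : Prop :=
  exists c, forall x, g x = c.

(* Smoothness is tested on the 2 pi-periodic lift, the projection [angle]
   being a local diffeomorphism. *)
Definition smooth_circle (R : realType) (g : circle R -> R) : Prop :=
  forall (n : nat) (x : R), derivable (derive1n n (g \o @angle R)) x 1.

Definition LC (R : realType) (g : circle R -> R) : set (circle R) :=
  [set x | exists c, \forall y \near x, g y = c].

Definition DZ (R : realType) (g : circle R -> R) : set (circle R) :=
  [set x | \forall y \near x, g y = 0].

Definition simple_dead_zones (R : realType) (g : circle R -> R) : Prop :=
  finite_set [set connected_component (DZ g) x | x in DZ g] /\ LC g = DZ g.

Definition coupling_function (R : realType) (g : circle R -> R) : Prop :=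
  [/\ smooth_circle g, ~ constant_fun g & simple_dead_zones g].

Definition torus (R : realType) (N : nat) : topologicalType :=
  prod_topology (fun _ : 'I_N => circle R).

Definition adjacency (R : realType) (N : nat) (A : rel 'I_N) : 'M[R]_N :=
  \matrix_(j, k) (A j k)%:R.

Definition network (R : realType) (N : nat) (A : rel 'I_N) (g : circle R -> R)
    (omega : R) (theta : torus R N) : 'I_N -> R :=
  fun k => omega +
    \sum_(j < N) adjacency R A j k * g (theta j - theta k).

Definition effective_graph (R : realType) (N : nat) (A : rel 'I_N)
    (g : circle R -> R) (theta : torus R N) : rel 'I_N :=
  fun j k => (adjacency R A j k != 0) && (theta j - theta k \notin DZ g).

Definition cut_edges (N : nat) (G : rel 'I_N) (vp vq : {set 'I_N}) :
    {set 'I_N * 'I_N} :=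
  [set e | [&& G e.1 e.2, e.1 \in vp & e.2 \in vq]]%SET.

Definition two_partition (N : nat) (v1 v2 : {set 'I_N}) : Prop :=
  v1 != v2 /\ finset.partition [set v1; v2]%SET [set: 'I_N]%SET.

Definition directed_cut (N : nat) (G : rel 'I_N) (v1 v2 : {set 'I_N}) : Prop :=
  cut_edges G v1 v2 <> finset.set0 /\ cut_edges G v2 v1 = finset.set0.

Definition disconnected_cut (N : nat) (G : rel 'I_N) (v1 v2 : {set 'I_N}) :
    Prop :=
  cut_edges G v1 v2 = finset.set0 /\ cut_edges G v2 v1 = finset.set0.

Definition block (N : nat) (v : {set 'I_N}) : Type := {i : 'I_N | i \in v}.

Definition coords (N : nat) (T : Type) (v : {set 'I_N}) (x : 'I_N -> T) :
    block v -> T :=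
  fun i => x (val i).
Arguments coords {N T} v x _.

(* [F2] is allowed not to depend on its first argument, so that a local product
   structure is in particular a local skew-product structure. *)
Definition local_skew_product (R : realType) (N : nat)
    (F : torus R N -> 'I_N -> R) (v1 v2 : {set 'I_N}) (theta : torus R N) :
    Prop :=
  exists (F1 : (block v1 -> circle R) -> (block v1 -> R))
         (F2 : (block v1 -> circle R) -> (block v2 -> circle R) ->
               (block v2 -> R)),
    \forall t \near theta,
      coords v1 (F t) = F1 (coords v1 t) /\
      coords v2 (F t) = F2 (coords v1 t) (coords v2 t).

Definition local_product (R : realType) (N : nat)
    (F : torus R N -> 'I_N -> R) (v1 v2 : {set 'I_N}) (theta : torus R N) :
    Prop :=
  exists (F1 : (block v1 -> circle R) -> (block v1 -> R))
         (F2 : (block v2 -> circle R) -> (block v2 -> R)),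
    \forall t \near theta,
      coords v1 (F t) = F1 (coords v1 t) /\
      coords v2 (F t) = F2 (coords v2 t).

(* Main.v *)
Require Import Defs.
From mathcomp Require Import all_boot all_order all_algebra.
From mathcomp Require Import all_classical all_reals all_analysis.
Import Order.TTheory GRing.Theory Num.Theory.
Import numFieldNormedType.Exports.
Local Open Scope classical_set_scope.
Local Open Scope ring_scope.

(** For a single block of oscillators [v], call the vector field autonomous in
    [v] near [theta] when the components indexed by [v] depend, near [theta],
    on the coordinates in [v] only.  A local skew product from [v1] to [v2] is
    the autonomy of [v1]: the second block is unconstrained, since the two
    families of coordinates together determine the point.  A local product is
    the autonomy of both blocks.  Both parts of the theorem thus follow by
    propositional logic from one equivalence ([locally_autonomousP]): [v] is
    autonomous near [theta] iff no edge of the effective graph at [theta]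
    enters [v] from its complement.

    If no effective edge enters [v], every existing edge from [j] outside [v]
    to [k] in [v] has its phase difference in the dead zone.  Subtraction on
    the circle is continuous and the dead zone is open, so the corresponding
    summand vanishes on a whole neighbourhood and the remaining sum involves
    only phases in [v].

    Conversely, suppose that [v] is autonomous and move the single phase
    [theta j], with [j] outside [v].  The [k]-th component, [k] in [v], must
    stay constant, while exactly one of its summands moves: that of the edge
    from [j] to [k].  Hence [g] is constant near [theta j - theta k], and since
    local constancy is the same as lying in the dead zone, that edge is not
    effective.

    The dichotomy between local constancy and dead zone holds at every phase
    difference, so the open dense set of phases is the whole torus. *)

(** * The circle as a topological group *)

Lemma angleB {R : realType} (x y : R) : angle (x - y) = angle x - angle y.
Proof. by rewrite /angle Quotient.pi_add Quotient.pi_opp. Qed.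

Lemma angle_eqP {R : realType} (x y : R) :
  angle x = angle y <-> x - y \in @twopiZ R.
Proof. by rewrite Quotient.idealrBE; split=> [xy|/eqP //]; exact/eqP. Qed.

Lemma angle_surj {R : realType} (x : circle R) : exists a, angle a = x.
Proof. by exists (repr x); exact: reprK. Qed.

Lemma angle_continuous {R : realType} : continuous (@angle R).
Proof. exact: pi_continuous. Qed.

(** The projection is open because saturating a set means taking the union of
    its translates by multiples of the period. *)
Lemma nbhs_angle_image {R : realType} (a : R) (U : set R) :
  nbhs a U -> nbhs (angle a) (@angle R @` U).
Proof.
rewrite nbhsE => -[V [oV Va] VU].
apply: (@filterS _ _ _ (@angle R @` V)) => [|].
  by move=> _ [x Vx <-]; exists x => //; exact: VU.
apply: open_nbhs_nbhs; split; last by exists a.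
rewrite /open/= /quotient_open.
suff -> : (@angle R) @^-1` (@angle R @` V) =
    \bigcup_(p in @twopiZ R) ((fun x => x - p) @^-1` V).
  apply: bigcup_open => p _; apply: open_comp => // x _.
  exact: (@cvgB _ _ _ _ _ _ _ _ _ cvg_id (cvg_cst p)).
apply/seteqP; split => [x [y Vy]|x [p Ip /= Vxp]].
  move=> /esym/angle_eqP xy.
  by exists (x - y) => //=; rewrite subKr.
by exists (x - p) => //; apply/esym/angle_eqP; rewrite subKr.
Qed.

Lemma circle_sub_continuous {R : realType} :
  continuous (fun p : circle R * circle R => p.1 - p.2).
Proof.
move=> -[x y]; have [a <-] := angle_surj x; have [b <-] := angle_surj y.
move=> W /=; rewrite -angleB => /angle_continuous nW.
have := @sub_continuous R (a, b) _ nW.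
move=> [[/= U V] [nU nV] UV].
exists (@angle R @` U, @angle R @` V); first by split; exact: nbhs_angle_image.
move=> [_ _] [/= [c Uc <-] [d Vd <-]]; rewrite -angleB.
exact: (UV (c, d)).
Qed.

Lemma circle_cvgB {R : realType} {T : Type} {F : set_system T}
    {FF : Filter F} (f h : T -> circle R) (x y : circle R) :
  f t @[t --> F] --> x -> h t @[t --> F] --> y ->
  (f t - h t) @[t --> F] --> x - y.
Proof.
move=> fx hy.
have C := cvg_comp _ _ (cvg_pair fx hy) (circle_sub_continuous (x, y)).
exact: C.
Qed.

Lemma phase_difference_continuous {R : realType} {N : nat} (j k : 'I_N) :
  continuous (fun t : torus R N => t j - t k).
Proof.
have coord_cvg (t : torus R N) i : s i @[s --> t] --> t i.
  exact: (@proj_continuous _ (fun=> circle R) i t).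
by move=> t; exact: circle_cvgB (coord_cvg t j) (coord_cvg t k).
Qed.

(** * Autonomous blocks *)

Definition locally_autonomous {R : realType} {N : nat}
    (F : torus R N -> 'I_N -> R) (v : {set 'I_N}) (theta : torus R N) : Prop :=
  exists G : (block v -> circle R) -> (block v -> R),
    \forall t \near theta, coords v (F t) = G (coords v t).

Definition extend {N : nat} {T : Type} (v : {set 'I_N}) (x : block v -> T)
    (y : 'I_N -> T) : 'I_N -> T :=
  fun i => if insub i is Some u then x u else y i.

Lemma extend_in {N : nat} {T : Type} (v : {set 'I_N}) (t y : 'I_N -> T) i :
  i \in v -> extend v (coords v t) y i = t i.
Proof. by move=> iv; rewrite /extend insubT. Qed.

Lemma extend_out {N : nat} {T : Type} (v : {set 'I_N}) (x : block v -> T)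
  (y : 'I_N -> T) i : i \notin v -> extend v x y i = y i.
Proof. by move=> iv; rewrite /extend insubF //; exact: negbTE. Qed.

Lemma cut_edges0P {N : nat} (G : rel 'I_N) (vp vq : {set 'I_N}) :
  cut_edges G vp vq = finset.set0 <->
  {in vp & vq, forall j k, ~~ G j k}.
Proof.
split=> [E0 j k jp kq|nG].
  apply/negP => Gjk; have : (j, k) \in cut_edges G vp vq.
    by rewrite inE Gjk jp.
  by rewrite E0 inE.
apply/setP => -[j k]; rewrite !inE /=; apply/negP => /and3P[Gjk jp kq].
by move: (nG j k jp kq); rewrite Gjk.
Qed.

Section NetworkAutonomy.
Context {R : realType} {N : nat} (A : rel 'I_N) (g : circle R -> R) (omega : R).
Implicit Types (theta t : torus R N) (v : {set 'I_N}).

Lemma ineffective_summand_near0 theta j k : ~~ effective_graph A g theta j k ->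
  \forall t \near theta, adjacency R A j k * g (t j - t k) = 0.
Proof.
rewrite negb_and !negbK => /orP[/eqP -> | ].
  by near=> t; rewrite mul0r.
move=> /set_mem dead.
have nd : \forall t \near theta, g (t j - t k) = 0.
  exact: (phase_difference_continuous j k theta _ dead).
near=> t; have -> : g (t j - t k) = 0 by near: t.
by rewrite mulr0.
Unshelve. all: by end_near.
Qed.

(** The summands entering [v] from outside vanish near [theta], so the
    remaining sums over [v] define the vector field of the block. *)
Lemma ineffective_cut_autonomous theta v :
  cut_edges (effective_graph A g theta) (~: v)%SET v = finset.set0 ->
  locally_autonomous (network A g omega) v theta.
Proof.
move=> /cut_edges0P nG.
exists (fun x k => let t := extend v x theta in
  omega + \sum_(j in v) adjacency R A j (val k) * g (t j - t (val k))).
have off : \forall t \near theta, forall e : 'I_N * 'I_N,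
    ~~ effective_graph A g theta e.1 e.2 ->
    adjacency R A e.1 e.2 * g (t e.1 - t e.2) = 0.
  apply: (@filter_forall _ _ (fun e : 'I_N * 'I_N => [set t : torus R N |
    ~~ effective_graph A g theta e.1 e.2 ->
    adjacency R A e.1 e.2 * g (t e.1 - t e.2) = 0]) (nbhs theta)) => e.
  case: (boolP (effective_graph A g theta e.1 e.2)) => [_|ne]; near=> t => //.
  by move=> _; near: t; exact: ineffective_summand_near0.
near=> t; have off_t := near off t.
apply/funext => -[k kv] /=.
rewrite /coords /network /=; congr (_ + _).
rewrite (bigID (mem v)) /= [X in _ + X]big1 ?addr0; last first.
  by move=> j jv; apply: (off_t _ (j, k)) => //; apply: nG => //; rewrite inE.
by apply: eq_bigr => j jv; rewrite !extend_in.
Unshelve. all: by end_near.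
Qed.

Hypothesis A_loopless : irreflexive A.
Hypothesis LC_DZ : LC g = DZ g.

(** Only one summand of the [k]-th component moves with the phase of [j], so
    autonomy makes [g] constant near the phase difference.  Looplessness
    ensures that [theta k] stays put when [theta j] moves. *)
Lemma autonomous_ineffective_cut theta v :
  locally_autonomous (network A g omega) v theta ->
  cut_edges (effective_graph A g theta) (~: v)%SET v = finset.set0.
Proof.
move=> [G FG]; apply/cut_edges0P => j k; rewrite inE => jv kv.
rewrite negb_and !negbK mxE.
have [Ajk|] := boolP (A j k); last by rewrite eqxx.
rewrite oner_eq0 /= -LC_DZ; apply/mem_set.
(* [move_j y] puts the phase of [j] where its difference to that of [k] is
   [y].  The translation by [theta k] is the subtraction of its opposite, so
   that its continuity is an instance of that of subtraction. *)
pose move_j (y : circle R) : torus R N :=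
  dfwith theta j (y - (- theta k)).
have subE : theta j - theta k - (- theta k) = theta j.
  by rewrite opprK subrK.
have move_j0 : move_j (theta j - theta k) = theta.
  apply: functional_extensionality_dep => i; rewrite /move_j subE.
  by have [<-|ij] := eqVneq j i; rewrite ?dfwithin // dfwithout.
have move_j_cvg : move_j y @[y --> theta j - theta k] --> theta.
  rewrite -[X in _ --> X]move_j0.
  have sub_cvg := @circle_cvgB R _ (nbhs (theta j - theta k)) _ id
    (fun=> - theta k) _ _ cvg_id (cvg_cst _).
  have dfwith_cvg := @dfwith_continuous _ (fun=> circle R) theta j
    (theta j - theta k - (- theta k)).
  have comp_cvg := cvg_comp _ _ (sub_cvg _ _) dfwith_cvg.
  exact: comp_cvg.
have near_F : \forall y \near theta j - theta k,
    network A g omega (move_j y) k = G (coords v theta) (exist _ k kv).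
  have nF := move_j_cvg _ FG; near=> y.
  have /(congr1 (fun h => h (exist _ k kv))) :
    coords v (network A g omega (move_j y)) = G (coords v (move_j y)).
    by near: y.
  rewrite /coords /= => ->; congr (G _ _); apply/funext => -[i iv] /=.
  by rewrite /move_j dfwithout //; apply: contraNneq jv => ->.
exists (G (coords v theta) (exist _ k kv) - omega
  - \sum_(i < N | i != j) adjacency R A i k * g (theta i - theta k)).
near=> y.
have <- : network A g omega (move_j y) k = G (coords v theta) (exist _ k kv).
  by near: y.
have kj : j != k by apply: contraTneq Ajk => ->; rewrite A_loopless.
rewrite /network (bigD1 j) //= mxE Ajk mul1r /move_j dfwithin dfwithout //.
rewrite opprK addrK [omega + _]addrC addrK.
rewrite [X in _ + X - _](eq_bigr
  (fun i => adjacency R A i k * g (theta i - theta k))) ?addrK // => i ij.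
by rewrite dfwithout // eq_sym.
Unshelve. all: by end_near.
Qed.

Lemma locally_autonomousP theta v :
  cut_edges (effective_graph A g theta) (~: v)%SET v = finset.set0 <->
  locally_autonomous (network A g omega) v theta.
Proof.
split; [exact: ineffective_cut_autonomous|exact: autonomous_ineffective_cut].
Qed.

End NetworkAutonomy.

(** * Product structures as autonomy of blocks *)

Lemma two_partition_setC {N : nat} (v1 v2 : {set 'I_N}) :
  two_partition v1 v2 -> v2 = (~: v1)%SET.
Proof.
move=> [v12 /and3P[/eqP cov tri _]]; apply/setP => i; rewrite inE.
have : i \in finset.cover [set v1; v2]%SET by rewrite cov inE.
rewrite /finset.cover finset.bigcup_setU !big_set1 inE.
have dis := finset.trivIsetP tri v1 v2 (set21 _ _) (set22 _ _) v12.
case: (boolP (i \in v1)) => [i1 _|_ /= ->] //=.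
by apply/negbTE; rewrite (disjointFr dis i1).
Qed.

Section Autonomy.
Context {R : realType} {N : nat} (F : torus R N -> 'I_N -> R).
Context (v : {set 'I_N}) (theta : torus R N).

Lemma local_skew_productE :
  local_skew_product F v (~: v)%SET theta <-> locally_autonomous F v theta.
Proof.
split=> [[F1 [F2 FE]]|[F1 FE]].
  by exists F1; apply: filterS FE => t [].
(* Together [x] and [y] cover all coordinates, so the point [theta] only serves
   as a default value. *)
exists F1, (fun x y => coords (~: v)%SET (F (extend v x (extend _ y theta)))).
apply: filterS FE => t ->; split=> //; congr (coords _ (F _)).
apply: functional_extensionality_dep => i.
have [iv|iv] := boolP (i \in v); first by rewrite extend_in.
by rewrite extend_out // extend_in // inE.
Qed.

Lemma local_productE w :
  local_product F v w theta <->
  locally_autonomous F v theta /\ locally_autonomous F w theta.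
Proof.
split=> [[F1 [F2 FE]]|[[F1 FE1] [F2 FE2]]].
  by split; [exists F1|exists F2]; apply: filterS FE => t [].
by exists F1, F2; apply: filterS2 FE1 FE2.
Qed.

End Autonomy.

Theorem proposition1 (R : realType) (N : nat) (A : rel 'I_N)
    (A_loopless : irreflexive A) (g : circle R -> R)
    (g_coupling : coupling_function g) (omega : R) :
  exists O : set (torus R N), [/\ open O, dense O &
    forall theta : torus R N, O theta ->
    forall v1 v2 : {set 'I_N}, two_partition v1 v2 ->
      (directed_cut (effective_graph A g theta) v1 v2 <->
         local_skew_product (network A g omega) v1 v2 theta /\
         ~ local_product (network A g omega) v1 v2 theta) /\
      (disconnected_cut (effective_graph A g theta) v1 v2 <->
         local_product (network A g omega) v1 v2 theta)].
Proof.
have [_ _ [_ LC_DZ]] := g_coupling.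
exists setT; split; [exact: openT|by move=> U U0 _; rewrite setIT|].
move=> theta _ v1 v2 /two_partition_setC ->.
have P1 := locally_autonomousP A g omega A_loopless LC_DZ theta v1.
have := locally_autonomousP A g omega A_loopless LC_DZ theta (~: v1)%SET.
rewrite finset.setCK => P2.
rewrite local_productE local_skew_productE -P1 -P2.
by rewrite /directed_cut /disconnected_cut; split; tauto.
Qed.
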